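(* Let $G$ be a finite simple connected graph, and let $h(G)$ denote the number of holes in $G$. Suppose that all the holes in $G$ are pairwise edge-disjoint and that $G$ has at most one non-edge maximal clique. If the clique number $\omega(G)$ satisfies $2\le \omega(G)\le h(G)+1$, then $$k(G)\le h(G)-\omega(G)+3.$$
   Context: A hole of a graph is an induced (chordless) cycle of length at least $4$. A clique is a complete subgraph; a clique is non-edge if it has at least $3$ vertices. $\omega(G)$ is the maximum number of vertices of a clique in $G$. For a digraph $D=(V,A)$, its competition graph $C(D)$ has vertex set $V$, with distinct $x,y$ adjacent iff there is $v\in V$ with $(x,v),(y,v)\in A$. The competition number $k(G)$ is the smallest $k\ge 0$ such that $G$ together with $k$ new isolated vertices is the competition graph of an acyclic digraph. *)

(* Defs.v *)
From mathcomp Require Import all_boot.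
Set Implicit Arguments. Unset Strict Implicit. Unset Printing Implicit Defensive.

Section Graphs.
Variable T : finType.
Variable e : rel T.

Definition simple_graph : Prop := symmetric e /\ irreflexive e.

Definition connected_graph : Prop := forall x y : T, connect e x y.

Definition induced (S : {set T}) : rel T :=
  fun x y => [&& e x y, x \in S & y \in S].

(* S is the vertex set of a hole: the induced subgraph on S is a cycle
   (connected and 2-regular) of length at least 4. *)
Definition is_hole (S : {set T}) : bool :=
  [&& 4 <= #|S|,
      [forall x in S, #|[set y in S | e x y]| == 2] &
      [forall x in S, forall y in S, connect (induced S) x y]].

Definition holes : {set {set T}} := [set S | is_hole S].

Definition num_holes : nat := #|holes|.

Definition holes_edge_disjoint : Prop :=
  forall S1 S2 : {set T}, is_hole S1 -> is_hole S2 -> S1 != S2 ->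
    forall x y, induced S1 x y -> ~~ induced S2 x y.

Definition is_clique (S : {set T}) : bool :=
  [forall x in S, forall y in S, (x != y) ==> e x y].

Definition maximal_clique (S : {set T}) : bool :=
  is_clique S && [forall S' : {set T}, (is_clique S' && (S \subset S')) ==> (S' == S)].

Definition nonedge_maximal_cliques : {set {set T}} :=
  [set S | maximal_clique S & 3 <= #|S|].

Definition clique_number : nat := \max_(S : {set T} | is_clique S) #|S|.

End Graphs.

Definition ext_adj (T : finType) (e : rel T) (k : nat) : rel (T + 'I_k)%type :=
  fun x y => match x, y with inl a, inl b => e a b | _, _ => false end.
Arguments ext_adj {T} e k.

(* a digraph (arc relation) is acyclic: no directed cycle (loops included) *)
Definition acyclic {V : finType} (a : rel V) : Prop :=
  forall x y : V, a x y -> ~~ connect a y x.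

Definition competition_graph_is (V : finType) (a : rel V) (g : rel V) : Prop :=
  forall x y : V, x != y -> g x y = [exists v, a x v && a y v].

Definition comp_realizable (T : finType) (e : rel T) (k : nat) : Prop :=
  exists a : rel (T + 'I_k)%type, acyclic a /\ competition_graph_is a (ext_adj e k).

(* k(G) <= n, k(G) being the least k with comp_realizable e k *)
Definition competition_number_le (T : finType) (e : rel T) (n : nat) : Prop :=
  exists k, k <= n /\ comp_realizable e k.

(* Main.v *)
(** Let [K] be a clique of maximum size [w]; all triangles lie in [K], so [K]
    and the edges not inside [K] cover the edges of the graph [G] on [n] vertices.

    Grow a connected vertex set from [K], one vertex [v] at a time. If [v] has [d]
    neighbours in the current set [S], they are pairwise nonadjacent, and shortest
    paths in [S] between them close up through [v] to at least [d - 1] holes. Hence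
    at most [n + h - w] edges are not inside [K].

    On the other hand, any graph with [m] edges has a vertex ordering in which edges
    are given private preys later in the order, all but [max (m - n + 2) 1] of them:
    remove a vertex of minimum degree and recurse. One new vertex serves [K] and one
    serves each edge left without prey. *)

Require Import Defs.
From mathcomp Require Import all_boot.
From mathcomp Require Import zify.
Set Implicit Arguments. Unset Strict Implicit. Unset Printing Implicit Defensive.

(** * Degree sums and the assignment of preys *)

Section DegreeSum.
Variables (T : finType) (r : rel T).

Definition degree_in (S : {set T}) (x : T) : nat := #|[set y in S | r x y]|.

(** For symmetric irreflexive [r] this is twice the number of edges inside [S]; edge counts stay
    doubled throughout to avoid halving. *)
Definition degree_sum (S : {set T}) : nat := \sum_(x in S) degree_in S x.

Hypotheses (r_sym : symmetric r) (r_irr : irreflexive r).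

Lemma degree_in_setU1 (S : {set T}) (v x : T) :
  v \notin S -> degree_in (v |: S) x = r x v + degree_in S x.
Proof.
move=> vS; rewrite /degree_in; case: (boolP (r x v)) => rxv.
  have -> : [set y in v |: S | r x y] = v |: [set y in S | r x y].
    by apply/setP=> y; rewrite !inE; case: eqP => [->|].
  by rewrite cardsU1 !inE (negbTE vS).
by congr #|pred_of_set _|; apply/setP=> y; rewrite !inE; case: eqP => [->|] //=;
  rewrite (negbTE rxv) andbF.
Qed.

Lemma degree_sum_setU1 (S : {set T}) (v : T) :
  v \notin S -> degree_sum (v |: S) = degree_sum S + (degree_in S v).*2.
Proof.
move=> vS; rewrite /degree_sum big_setU1 //= degree_in_setU1 // r_irr add0n.
under eq_bigr => x _ do rewrite degree_in_setU1 //.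
rewrite big_split /= -addnn addnCA addnA [RHS]addnC; congr (_ + _); rewrite addnC.
congr (_ + _); rewrite /degree_in -sum1_card big_mkcond [RHS]big_mkcond /=.
by apply: eq_bigr => x _; rewrite !inE r_sym; case: (x \in S); case: (r v x).
Qed.

Lemma min_degree (S : {set T}) (x0 : T) :
  x0 \in S -> exists2 v, v \in S & #|S| * degree_in S v <= degree_sum S.
Proof.
move=> x0S; case: (arg_minnP (degree_in S) x0S) => v vS vmin.
by exists v => //; rewrite -sum_nat_const leq_sum.
Qed.

(* A vertex [w] is the common prey of the set [prey w]; the edges listed in [L]
   are those still waiting for a prey. Vertices are inserted so that each one
   has minimum degree among its predecessors, and receives a waiting edge. *)
Lemma prey_assignment (S : {set T}) :
  exists (rank : T -> nat) (prey : T -> {set T}) (L : seq {set T}),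
    [/\ forall w, is_clique r (prey w) /\ prey w \subset S,
        forall w, w \notin S -> prey w = set0,
        forall w x, x \in prey w -> rank x < rank w,
        forall F, F \in L -> is_clique r F /\ F \subset S &
        (forall x y, x \in S -> y \in S -> r x y ->
           (exists w, (x \in prey w) && (y \in prey w)) \/
           (exists2 F, F \in L & (x \in F) && (y \in F))) /\
        (size L <= 1 \/ (size L).*2 + #|S|.*2 <= degree_sum S + 4)].
Proof.
have clique0 : is_clique r set0 by apply/forall_inP=> x; rewrite inE.
elim: {S}_.+1 {-2}S (ltnSn #|S|) => // m IH S leSm.
case: (set_0Vmem S) => [->|[x0 /min_degree [v vS vmin]]].
  exists (fun=> 0), (fun=> set0), [::]; split => //.
  - by move=> w x; rewrite inE.
  - by split; [move=> x y; rewrite inE | left].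
pose S' := S :\ v; have vS' : v \notin S' by rewrite !inE eqxx.
have defS : S = v |: S' by rewrite setD1K.
have cardS : #|S| = #|S'|.+1 by rewrite defS cardsU1 vS'.
have [|rank [prey [L [preyC prey0 rankP LC [cov szL]]]]] := IH S'; first by lia.
have degv : degree_in S v = degree_in S' v by rewrite {1}defS degree_in_setU1 // r_irr.
have sS'S : S' \subset S by rewrite subsetDl.
pose N := [set y in S' | r v y].
(* The new vertex gets the top rank and becomes the prey of the first waiting edge, or of nothing
   ([set0]) if none waits. Its edges to earlier vertices join the waiting list. *)
exists (fun x => if x == v then (\max_y rank y).+1 else rank x),
  (fun w => if w == v then head set0 L else prey w),
  (behead L ++ [seq [set v; y] | y <- enum N]).
have headC : is_clique r (head set0 L) /\ head set0 L \subset S'.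
  case: L LC {cov szL} => [|F L] LC /=; first by rewrite sub0set.
  by apply: LC; rewrite inE eqxx.
split.
- move=> w; case: eqP => _; last by have [? /subset_trans ->] := preyC w.
  by have [? /subset_trans ->] := headC.
- move=> w wS; case: eqP => [E|_]; first by rewrite E vS in wS.
  by apply: prey0; apply: contraNN wS => /(subsetP sS'S).
- move=> w x; case: (w =P v) => [_|_] xw.
    have xS' : x \in S' by have [_ /subsetP] := headC; apply.
    case: eqP => [E|_]; first by rewrite E (negbTE vS') in xS'.
    by rewrite ltnS (leq_bigmax x).
  have xS' : x \in S' by have [_ /subsetP] := preyC w; apply.
  case: eqP => [E|_]; first by rewrite E (negbTE vS') in xS'.
  exact: rankP.
- move=> F; rewrite mem_cat => /orP[/mem_behead FL|].
    by have [? /subset_trans ->] := LC _ FL.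
  case/mapP => y; rewrite mem_enum !inE => /andP[/andP[yv yS] rvy] ->; split.
    apply/forall_inP=> a; rewrite !inE => /orP[]/eqP->;
    apply/forall_inP=> b; rewrite !inE => /orP[]/eqP->; rewrite ?eqxx // ?rvy ?implybT //.
    by rewrite r_sym rvy implybT.
  by apply/subsetP=> a; rewrite !inE => /orP[]/eqP->.
- split.
    have covv y : y \in S' -> r v y ->
        exists2 F, F \in behead L ++ [seq [set v; y] | y <- enum N] & (v \in F) && (y \in F).
      move=> yS' rvy; exists [set v; y]; last by rewrite !inE !eqxx orbT.
      rewrite mem_cat; apply/orP; right; apply/mapP; exists y => //.
      by rewrite mem_enum in_set yS'.
    move=> x y; rewrite {1 2}defS !in_setU1.
    case: (x =P v) => [->|_] /=; case: (y =P v) => [->|_] /=; rewrite ?r_irr //.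
    + by move=> _ yS' rvy; right; apply: covv.
    + move=> xS' _; rewrite r_sym => rvx; right.
      by have [F FL] := covv _ xS' rvx; rewrite andbC; exists F.
    move=> xS' yS' rxy; case: (cov _ _ xS' yS' rxy) => [[w xyw]|[F FL xyF]].
      left; exists w; case: (w =P v) => // E.
      by rewrite E prey0 // !inE in xyw.
    case: L {LC szL headC cov covv} FL => // F' L; rewrite inE /= => /predU1P[E|FL].
      by left; exists v; rewrite eqxx -E.
    by right; exists F; rewrite ?mem_cat ?FL.
have szN : #|N| = degree_in S v by rewrite degv.
have dleS : degree_in S v <= #|S'|.
  by rewrite degv; apply/subset_leq_card/subsetP=> y; rewrite inE => /andP[].
rewrite size_cat size_behead size_map -cardE szN cardS.
have := degree_sum_setU1 vS'; rewrite -defS -degv => DS.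
rewrite cardS in vmin.
(* With a nonempty list, one edge leaves and [degree_in S v] edges enter, while the set grows by one
   vertex and the degree sum by twice that degree: the second bound is preserved. *)
case: szL => szL; last by case: (size L) szL => [|l] szL; nia.
have -> : (size L).-1 = 0 by lia.
case: (leqP (degree_in S v) 1) => d1; first by left.
(* Write [d] for the degree of [v]. Minimality gives a degree sum of at least [#|S| * d], and
   [(#|S| - 2) * (d - 2) >= 0] since [2 <= d < #|S|]. *)
by right; nia.
Qed.

End DegreeSum.

(** * From preys to an acyclic digraph *)

Lemma realizable_of_prey (T : finType) (e : rel T) (rank : T -> nat)
    (prey : T -> {set T}) (L : seq {set T}) :
  (forall w, is_clique e (prey w)) -> (forall F, F \in L -> is_clique e F) ->
  (forall w x, x \in prey w -> rank x < rank w) ->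
  (forall x y, e x y ->
     (exists w, (x \in prey w) && (y \in prey w)) \/
     (exists2 F, F \in L & (x \in F) && (y \in F))) ->
  comp_realizable e (size L).
Proof.
move=> preyC LC rankP cov.
(* In-neighbourhoods are the sets [prey w] and the entries of [L], one new vertex per entry. New
   vertices lie above all ranks and have no outgoing arc, so every arc raises [rk]. *)
pose arc (x y : T + 'I_(size L)) := match x, y with
  | inl a, inl b => a \in prey b
  | inl a, inr i => a \in nth set0 L i
  | inr _, _ => false end.
pose rk (x : T + 'I_(size L)) := match x with
  | inl a => rank a | inr _ => (\max_y rank y).+1 end.
have arc_rk x y : arc x y -> rk x < rk y.
  case: x => // a; case: y => [b|i] /=; first exact: rankP.
  by move=> _; rewrite ltnS (leq_bigmax a).
have conn_rk x y : connect arc x y -> rk x <= rk y.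
  case/connectP=> p; elim: p x => [|z p IH] x /=; first by move=> _ ->.
  by case/andP=> /arc_rk/ltnW xz pz E; apply: leq_trans xz (IH _ pz E).
exists arc; split.
  move=> x y /arc_rk xy; apply/negP=> /conn_rk yx.
  by have := leq_trans xy yx; rewrite ltnn.
have cliqueE F a b : is_clique e F -> a \in F -> b \in F -> a != b -> e a b.
  by move=> /forall_inP FC aF bF ab; move: (FC _ aF) => /forall_inP/(_ _ bF)/implyP; apply.
move=> x y xy; apply/idP/existsP.
  case: x xy => [a|i] // xy; case: y xy => [b|j] //= xy /cov[[w abw]|[F FL abF]].
    by exists (inl w).
  move: FL; rewrite -index_mem => FL.
  by exists (inr (Ordinal FL)); rewrite /= nth_index // -index_mem.
case=> w; case: x xy => [a|i]; case: y => [b|j] //= ab; rewrite ?andbF //.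
have {}ab : a != b by apply: contraNneq ab => ->.
case: w => [w|i] /= /andP[aF bF]; first exact: cliqueE (preyC w) _ _ _.
exact: cliqueE (LC _ (mem_nth set0 (ltn_ord i))) _ _ _.
Qed.

(** * Construction of holes from shortest walks *)

Section Holes.
Variables (T : finType) (e : rel T).
Hypotheses (e_sym : symmetric e) (e_irr : irreflexive e).

Lemma induced_sym (S : {set T}) : symmetric (induced e S).
Proof. by move=> x y; rewrite /induced e_sym [(x \in S) && _]andbC. Qed.

(** A bridge from an explicit cyclic ordering to holes defined by 2-regularity and connectivity; by
    symmetry only index pairs [i < j] have to be checked. *)
Lemma is_hole_cycle (n : nat) (c : nat -> T) :
  4 <= n ->
  (forall i j, i < j < n -> c i != c j) ->
  (forall i j, i < j < n -> e (c i) (c j) = (j == i.+1) || ((i == 0) && (j == n.-1))) ->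
  is_hole e [set c i | i : 'I_n].
Proof.
move=> n4 c_neq c_adj; set H := [set _ | _ : _].
have c_inj i j : i < n -> j < n -> c i = c j -> i = j.
  move=> lin ljn E; case: (ltngtP i j) => // ij.
    by have := c_neq i j; rewrite ij ljn E eqxx => /(_ isT).
  by have := c_neq j i; rewrite ij lin E eqxx => /(_ isT).
have inH i : i < n -> c i \in H by move=> lin; apply/imsetP; exists (Ordinal lin).
have HP x : x \in H -> exists2 i, i < n & x = c i.
  by case/imsetP=> i _ ->; exists i.
apply/and3P; split.
- rewrite card_imset ?card_ord // => i j E.
  by apply/val_inj/c_inj; rewrite ?ltn_ord.
- apply/forall_inP=> x /HP[i lin ->].
  pose prv := if i == 0 then n.-1 else i.-1.
  pose nxt := if i == n.-1 then 0 else i.+1.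
  have prvn : prv < n by rewrite /prv; case: eqP; lia.
  have nxtn : nxt < n by rewrite /nxt; case: eqP; lia.
  have -> : [set y in H | e (c i) y] = [set c prv; c nxt].
    apply/setP=> y; rewrite !inE; case: (boolP (y \in H)) => [/HP[j ljn ->]|yH] /=.
      have cE k : k < n -> (c j == c k) = (j == k).
        by move=> lkn; apply/eqP/eqP => [/c_inj->|->].
      rewrite !cE // /prv /nxt; case: (ltngtP i j) => [ij|ji|<-];
        case: (i =P 0) => i0; case: (i =P n.-1) => i1; 
        rewrite ?e_irr; try lia; try (by rewrite c_adj ?ij //; lia);
        by rewrite e_sym c_adj ?ji //; lia.
    by apply/esym/negP => /orP[]/eqP E; rewrite E inH in yH.
  rewrite cards2; suff -> : c prv != c nxt by [].
  by apply/eqP=> /c_inj; move=> /(_ prvn nxtn); rewrite /prv /nxt;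
    case: (i =P 0); case: (i =P n.-1); lia.
- have conn0 i : i < n -> connect (induced e H) (c 0) (c i).
    elim: i => // i IH lin; apply: connect_trans (IH (ltnW lin)) (connect1 _).
    by rewrite /induced !inH ?(ltnW lin) // c_adj ?eqxx // ltnSn.
  apply/forall_inP=> x /HP[i lin ->]; apply/forall_inP=> y /HP[j ljn ->].
  apply: connect_trans (conn0 _ ljn).
  by rewrite (sym_connect_sym (@induced_sym H)) conn0.
Qed.

(** A walk is a function on [nat], so that cutting it is arithmetic on indices; its values beyond
    [m] do not matter. *)
Definition walk_between (S A B : {set T}) (m : nat) (w : nat -> T) : Prop :=
  [/\ w 0 \in A, w m \in B, forall i, i <= m -> w i \in S &
      forall i, i < m -> e (w i) (w i.+1)].

Lemma walk_of_connect (S A B : {set T}) (x y : T) :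
  x \in A -> y \in B -> x \in S -> connect (induced e S) x y ->
  exists m w, walk_between S A B m w.
Proof.
move=> xA yB xS /connectP[p pth yE]; exists (size p), (nth x (x :: p)).
split => //=.
- by rewrite -(last_nth x) -yE.
- case=> // i ip; move/(pathP x): pth => /(_ i ip) /and3P[]//.
- by move=> i ip; move/(pathP x): pth => /(_ i ip) /and3P[].
Qed.

(** After the [d] vertices following [w i] are dropped, either the walk stops at [w i] or an edge
    bridges the gap. This removes repeated vertices ([d = j - i]) as well as chords
    ([d = j - i.+1]). *)
Lemma walk_shortcut (S A B : {set T}) (m i d : nat) (w : nat -> T) :
  walk_between S A B m w -> i + d <= m ->
  (i + d = m -> w i \in B) -> (i + d < m -> e (w i) (w (i + d).+1)) ->
  walk_between S A B (m - d) (fun k => if k <= i then w k else w (k + d)).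
Proof.
move=> [w0 wm wS wE] idm wiB wiE; split => //.
- case: leqP => mdi; last by rewrite subnK //; lia.
  have -> : m - d = i by lia.
  by apply: wiB; lia.
- by move=> k km; case: leqP => ki; apply: wS; lia.
- move=> k km; case: (ltngtP k i) => ki; first by apply: wE; lia.
    by rewrite addSn; apply: wE; lia.
  by rewrite ki addSn; apply: wiE; lia.
Qed.

(* A shortest walk from [A] to [N :\: A] is an induced path without interior
   vertex in [N]; closing it through [v] gives the hole. *)
Lemma hole_between (S N A : {set T}) (v x y : T) :
  v \notin S -> N = [set u in S | e v u] ->
  {in N &, forall u u', ~~ e u u'} ->
  {in S &, forall a b, connect (induced e S) a b} ->
  A \subset N -> x \in A -> y \in N :\: A ->
  [exists H, exists u, [&& is_hole e H, v \in H, H \subset v |: S,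
    u \in N :\: A, u \in H & H :&: N \subset u |: A]].
Proof.
move=> vS defN indep connS sAN xA yNA.
have sNS u : u \in N -> u \in S by rewrite defN inE => /andP[].
have xS : x \in S by apply: sNS; apply: (subsetP sAN).
have yS : y \in S by case/setDP: yNA => /sNS.
have [m [w]] := walk_of_connect xA yNA xS (connS _ _ xS yS).
elim: m {-2}m (leqnn m) w => [|M IH] m leM w wlk.
  have [w0 wm _ _] := wlk; move: leM wm; rewrite leqn0 => /eqP->.
  by rewrite inE w0.
apply: contraT => no_hole.
(* By induction a shorter walk would already yield the hole, so [w] may be treated as shortest. *)
have short m' w' : m' < m -> walk_between S A (N :\: A) m' w' -> False.
  move=> lm /(IH _ _) IHw; move/negP: no_hole; apply; apply: IHw.
  by rewrite -ltnS (leq_trans lm).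
have [w0 wm wS wE] := wlk; have /setDP[wmN wmA] := wm.
have w_neq i j : i < j <= m -> w i != w j.
  case/andP=> ij jm; apply/eqP=> E.
  apply: (short (m - (j - i)) (fun k => if k <= i then w k else w (k + (j - i)))).
    by clear -ij jm; lia.
  apply: walk_shortcut => //; rewrite subnKC ?(ltnW ij) // ?E => jm'; last exact: wE.
  by rewrite jm'.
have chordless i j : i < j <= m -> e (w i) (w j) = (j == i.+1).
  case/andP=> ij jm; apply/idP/eqP => [wij|ji]; last by rewrite ji in jm *; apply: wE.
  apply/eqP; apply: contraT => nij; exfalso.
  apply: (short (m - (j - i.+1)) (fun k => if k <= i then w k else w (k + (j - i.+1)))).
    by clear -ij jm nij; lia.
  have jE : (i + (j - i.+1)).+1 = j by clear -ij; lia.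
  apply: walk_shortcut => // [|E|]; last by rewrite jE.
    by clear -jE jm; lia.
  by exfalso; clear -jE E jm; lia.
(* An interior vertex in [N] would shorten the walk: start there if it lies in [A], stop there
   otherwise. *)
have wN i : i <= m -> (w i \in N) = (i == 0) || (i == m).
  move=> im; case: (posnP i) => [->|i0] /=; first exact: (subsetP sAN).
  case: (i =P m) => [->//|/eqP nim]; apply/negP=> wiN.
  have ltim : i < m by rewrite ltn_neqAle nim.
  case: (boolP (w i \in A)) => wiA.
    apply: (short (m - i) (fun k => w (k + i))); first by clear -i0 im; lia.
    split=> [||k km|k km]; rewrite ?subnK //.
      by apply: wS; clear -km im; lia.
    by rewrite addSn; apply: wE; clear -km im; lia.
  apply: (short i w) => //; split=> // [|k ki|k ki]; first by rewrite inE wiA.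
    exact: wS (leq_trans ki im).
  exact: wE (ltn_trans ki ltim).
have m2 : 1 < m.
  case: (posnP m) => [m0|m_gt0]; first by rewrite m0 w0 in wmA.
  rewrite ltn_neqAle m_gt0 andbT; apply/eqP=> m1.
  by have := indep _ _ (subsetP sAN _ w0) wmN; rewrite -m1 wE // -m1.
(* Index [m.+1] gives [v], so the cycle has [m.+2] vertices, at least four because [1 < m]. *)
pose c i := if i <= m then w i else v.
have wv i : i <= m -> w i != v by move=> im; apply: contraNneq vS => <-; apply: wS.
have holeH : is_hole e [set c i | i : 'I_m.+2].
  apply: is_hole_cycle => // i j /andP[ij jm].
    have im : i <= m by clear -ij jm; lia.
    by rewrite /c im; case: leqP => jm'; rewrite ?wv // w_neq // ij.
  have im : i <= m by clear -ij jm; lia.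
  rewrite /c im; case: leqP => jm'; first by rewrite chordless ?ij //; clear -jm'; lia.
  rewrite e_sym; have := wN i im; rewrite defN inE wS //=.
  by move=> ->; clear -jm jm'; lia.
move/negP: no_hole; case; apply/existsP; exists [set c i | i : 'I_m.+2].
apply/existsP; exists (w m); rewrite holeH wm /=.
have inH i : i < m.+2 -> c i \in [set c i | i : 'I_m.+2].
  by move=> im; apply/imsetP; exists (Ordinal im).
have := inH m (leqnSn _); rewrite {1}/c leqnn => ->.
have := inH m.+1 (ltnSn _); rewrite {1}/c ltnn => -> /=; apply/andP; split.
  apply/subsetP=> z /imsetP[i _ ->]; rewrite !inE /c.
  by case: leqP => im; rewrite ?eqxx // wS ?orbT.
apply/subsetP=> z /setIP[/imsetP[i _ ->]]; rewrite !inE /c; case: leqP => im.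
  by rewrite wN // => /orP[]/eqP->; rewrite ?w0 ?eqxx ?orbT.
by move/sNS => vS'; rewrite vS' in vS.
Qed.

(** * Counting holes while the vertex set grows *)

Definition holes_in (S : {set T}) : {set {set T}} := [set H in holes e | H \subset S].

(** Collect the neighbours of [v] one by one in a set [A]. Each new neighbour [u] lies on a hole
    through [v] that meets [N] only in [u] and [A]: it is new, as earlier holes either avoid [v] or
    meet [N] only inside the old [A]. *)
Lemma holes_in_setU1 (S : {set T}) (v : T) :
  v \notin S ->
  {in S &, forall u u', e v u -> e v u' -> ~~ e u u'} ->
  {in S &, forall a b, connect (induced e S) a b} ->
  #|holes_in S| + degree_in e S v <= #|holes_in (v |: S)| + 1.
Proof.
move=> vS indep connS; rewrite /degree_in; set N := [set u in S | e v u].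
have indepN : {in N &, forall u u', ~~ e u u'}.
  by move=> u u'; rewrite !inE => /andP[uS vu] /andP[u'S vu']; apply: indep.
have [->|[x xN]] := set_0Vmem N.
  rewrite cards0 addn0 (leq_trans _ (leq_addr 1 _)) // subset_leq_card //.
  apply/subsetP=> H; rewrite !inE => /andP[-> HS] /=.
  exact: subset_trans HS (subsetUr _ _).
(* The first neighbour [x] brings no hole, hence [k.+1] neighbours for [k] holes and the final
   [+ 1]. *)
suff grow k : k < #|N| -> exists A : {set T}, [/\ x \in A, A \subset N, #|A| = k.+1 &
    #|holes_in S| + k <= #|[set H in holes_in (v |: S) | H :&: N \subset A]
                            :|: holes_in S|].
  have N0 : 0 < #|N| by apply/card_gt0P; exists x.
  have [|A [_ _ _ leA]] := grow #|N|.-1; first by rewrite prednK.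
  rewrite -(prednK N0) addn1 addnS ltnS (leq_trans leA) // subset_leq_card //.
  apply/subsetP=> H; rewrite !inE => /orP[/andP[]|/andP[-> HS]] //=.
  exact: subset_trans HS (subsetUr _ _).
elim: k => [|k IH] kN.
  exists [set x]; rewrite set11 cards1 sub1set xN addn0 subset_leq_card //.
  by rewrite subsetUr.
have [A [xA sAN cA leA]] := IH (ltnW kN).
have /subsetPn[y yN yA] : ~~ (N \subset A).
  by apply/negP=> /subset_leq_card; rewrite cA leqNgt kN.
have yNA : y \in N :\: A by rewrite inE yA.
have /existsP[H /existsP[u /and5P[holeH vH HS uNA /andP[uH HNA]]]] :=
  hole_between vS (erefl N) indepN connS sAN xA yNA.
have /setDP[uN uA] := uNA.
exists (u |: A); split; first by rewrite inE xA orbT.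
- by rewrite subUset sub1set uN.
- by rewrite cardsU1 uA cA.
set X := _ :|: _ in leA; set Y := _ :|: _.
have HX : H \notin X.
  rewrite !inE !negb_or !negb_and; apply/andP; split; apply/orP; right.
    by apply: contraNN uA => /subsetP; apply; rewrite inE uH.
  by apply: contraNN vS => /subsetP; apply.
have sub : H |: X \subset Y.
  apply/subsetP=> H'; rewrite !inE => /predU1P[->|]; first by rewrite holeH HS HNA.
  case/orP=> [/andP[-> H'A]|->] /=; last by rewrite orbT.
  by rewrite (subset_trans H'A (subsetUr _ _)).
rewrite addnS; apply: leq_ltn_trans leA _.
by move: (subset_leq_card sub); rewrite cardsU1 HX.
Qed.

Definition edges_off (K : {set T}) : rel T :=
  fun x y => e x y && ~~ ((x \in K) && (y \in K)).

Lemma edges_off_sym (K : {set T}) : symmetric (edges_off K).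
Proof. by move=> x y; rewrite /edges_off e_sym [(x \in K) && _]andbC. Qed.

Lemma edges_off_irr (K : {set T}) : irreflexive (edges_off K).
Proof. by move=> x; rewrite /edges_off e_irr. Qed.

(* The number of holes is at least the cycle rank of the graph with [K]
   contracted to a point. *)
Lemma degree_sum_le_holes (K : {set T}) (x0 : T) :
  connected_graph e -> is_clique e K -> x0 \in K ->
  (forall x y z, e x y -> e y z -> e x z -> x \in K) ->
  degree_sum (edges_off K) [set: T] + #|K|.*2 <= (num_holes e).*2 + #|T|.*2.
Proof.
move=> connG cK x0K triK.
(* [S] is [K] with [k] vertices added. For [S = K] no edge counts; each step adds at most one more
   edge than holes, and the new vertex pays for that edge. *)
suff grow k : k <= #|T| - #|K| -> exists S : {set T}, [/\ K \subset S, #|S| = #|K| + k,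
    {in S &, forall a b, connect (induced e S) a b} &
    degree_sum (edges_off K) S + #|K|.*2 <= #|holes_in S|.*2 + #|S|.*2].
  have [S [_ cardS _]] := grow _ (leqnn _).
  have -> : S = [set: T].
    by apply/eqP; rewrite eqEcard subsetT cardsT cardS subnKC // max_card.
  rewrite cardsT; suff -> : holes_in [set: T] = holes e by [].
  by apply/setP=> H; rewrite inE subsetT andbT.
elim: k => [|k IH] kT.
  exists K; rewrite addn0; split => //.
    move=> a b aK bK; case: (eqVneq a b) => [->|ab]; first exact: connect0.
    apply: connect1; rewrite /induced aK bK !andbT.
    by move: cK => /forall_inP/(_ _ aK)/forall_inP/(_ _ bK)/implyP; apply.
  rewrite /degree_sum big1 ?leq_addl // => a aK; apply/eqP; rewrite cards_eq0.
  by apply/eqP/setP=> b; rewrite !inE /edges_off aK; case: (b \in K); rewrite ?andbF.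
have [S [sKS cardS connS leS]] := IH (ltnW kT).
have x0S : x0 \in S by apply: (subsetP sKS).
(* The first vertex outside [S] on a path leaving [S]. *)
have [v [vS [u uS vu]]] : exists v, v \notin S /\ exists2 u, u \in S & e v u.
  have /subsetPn[z _ zS] : ~~ ([set: T] \subset S).
    by apply/negP=> /subset_leq_card; rewrite cardsT cardS; clear -kT; lia.
  have /connectP[p] := connG x0 z; elim: p x0 x0S {x0K} => [|a p IHp] x xS /=.
    by move=> _ E; rewrite E xS in zS.
  case/andP=> xa; case: (boolP (a \in S)) => [aS|aS] pth E; first exact: IHp aS pth E.
  by exists a; split=> //; exists x; rewrite // e_sym.
have vK : v \notin K by apply: contraNN vS => /(subsetP sKS).
exists (v |: S); split.
- exact: subset_trans sKS (subsetUr _ _).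
- by rewrite cardsU1 vS cardS addnS.
- have sub a b : connect (induced e S) a b -> connect (induced e (v |: S)) a b.
    apply: connect_sub => {}a {}b /and3P[ab aS bS]; apply: connect1.
    by rewrite /induced ab !inE aS bS !orbT.
  have uv : connect (induced e (v |: S)) u v.
    by apply: connect1; rewrite /induced e_sym vu !inE uS eqxx orbT.
  have toU a : a \in v |: S -> connect (induced e (v |: S)) u a.
    by case/setU1P=> [->//|aS]; apply/sub/connS.
  move=> a b /toU ua /toU; apply: connect_trans.
  by rewrite (sym_connect_sym (@induced_sym _)).
(* Two adjacent neighbours of [v] would form a triangle with it and force [v] into [K]. *)
have indep : {in S &, forall a b, e v a -> e v b -> ~~ e a b}.
  by move=> a b _ _ va vb; apply: contraNN vK => ab; apply: (triK v a b).
have := holes_in_setU1 vS indep connS.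
have -> : degree_in e S v = degree_in (edges_off K) S v.
  by congr #|pred_of_set _|; apply/setP=> a; rewrite !inE /edges_off (negbTE vK) andbT.
rewrite (degree_sum_setU1 (@edges_off_sym K) (@edges_off_irr K)) // cardsU1 vS.
by move: leS; clear; lia.
Qed.

(** * Maximum cliques and triangles *)

Lemma clique_extends (S : {set T}) :
  is_clique e S -> exists2 M, maximal_clique e M & S \subset M.
Proof.
move=> cS; have [M /maxsetP[cM maxM] sSM] := @maxset_exists _ (is_clique e) S cS.
exists M => //; rewrite /maximal_clique cM; apply/forallP=> M'; apply/implyP.
by case/andP=> cM' sMM'; rewrite (maxM M').
Qed.

Lemma leq_clique_number (S : {set T}) : is_clique e S -> #|S| <= clique_number e.
Proof. by move=> cS; apply: (leq_bigmax_cond (F := fun S : {set T} => #|S|)). Qed.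

Lemma max_clique_exists :
  exists2 K, is_clique e K & #|K| = clique_number e.
Proof.
have c0 : is_clique e set0 by apply/forall_inP=> x; rewrite inE.
have ex_clique : 0 < #|is_clique e| by apply/card_gt0P; exists set0.
have [K cK cardK] := eq_bigmax_cond (fun S : {set T} => #|S|) ex_clique.
by exists K.
Qed.

(** The triangle extends to a maximal clique. [K] is maximal too, and once a triangle exists it has
    at least three vertices, so the two cliques coincide. *)
Lemma triangle_in_max_clique (K : {set T}) (x y z : T) :
  #|nonedge_maximal_cliques e| <= 1 -> is_clique e K -> #|K| = clique_number e ->
  e x y -> e y z -> e x z -> x \in K.
Proof.
move=> le1 cK cardK xy yz xz.
have neq a b : e a b -> a != b by move=> ab; apply: contraTneq ab => ->; rewrite e_irr.
pose t := [set x; y; z].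
have ct : is_clique e t.
  apply/forall_inP=> a /[!inE] /orP[/orP[]|] /eqP->;
  apply/forall_inP=> b /[!inE] /orP[/orP[]|] /eqP->;
  by rewrite ?eqxx // ?xy ?yz ?xz ?implybT // e_sym ?xy ?yz ?xz implybT.
have card_t : 3 <= #|t|.
  rewrite /t [X in #|pred_of_set X|]setUC cardsU1 cards2 !inE (neq _ _ xy).
  by rewrite !(eq_sym z) (negbTE (neq _ _ xz)) (negbTE (neq _ _ yz)).
have [M mM stM] := clique_extends ct; have [K' mK' sKK'] := clique_extends cK.
have KK' : K = K'.
  apply/eqP; rewrite eqEcard sKK' cardK leq_clique_number //.
  by case/andP: mK'.
have Kn : K \in nonedge_maximal_cliques e.
  by rewrite inE {1}KK' mK' cardK (leq_trans card_t) // leq_clique_number.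
have Mn : M \in nonedge_maximal_cliques e.
  by rewrite inE mM (leq_trans card_t) // subset_leq_card.
move/card_le1_eqP: le1 => /(_ M K Mn Kn) ->.
by apply: (subsetP stM); rewrite !inE eqxx.
Qed.

End Holes.

(** * Combination of the two counts *)

Theorem theorem2 (T : finType) (e : rel T) :
  simple_graph e ->
  connected_graph e ->
  holes_edge_disjoint e ->
  #|nonedge_maximal_cliques e| <= 1 ->
  2 <= clique_number e <= num_holes e + 1 ->
  competition_number_le e (num_holes e + 3 - clique_number e).
Proof.
move=> [e_sym e_irr] connG _ le1 /andP[w2 wh].
have [K cK cardK] := max_clique_exists e.
have [x0 x0K] : exists x, x \in K by apply/card_gt0P; rewrite cardK ltnW.
have triK x y z := @triangle_in_max_clique T e e_sym e_irr K x y z le1 cK cardK.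
have holes_ge := degree_sum_le_holes e_sym e_irr connG cK x0K triK.
have [rank [prey [L [preyC _ rankP LC [cov szL]]]]] :=
  prey_assignment (edges_off_sym e_sym K) (edges_off_irr e_irr K) [set: T].
have clique_off F : is_clique (edges_off e K) F -> is_clique e F.
  move/forall_inP=> cF; apply/forall_inP=> x /cF/forall_inP{}cF.
  by apply/forall_inP=> y /cF/implyP xy; apply/implyP=> /xy/andP[].
exists (size (K :: L)); split.
  (* If [size L <= 1], two new vertices suffice, and [wh] makes the bound at least 2. Otherwise
     [szL] and [holes_ge] give [size L + #|K| <= num_holes e + 2], and [K] takes one more vertex. *)
  by rewrite cardsT in szL; move: w2 wh szL holes_ge; rewrite -cardK /=; clear; lia.
apply: realizable_of_prey (rankP) _.
- by move=> w; apply/clique_off; case: (preyC w).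
- by move=> F; rewrite inE => /predU1P[->//|/LC[/clique_off]].
move=> x y xy; case: (boolP ((x \in K) && (y \in K))) => xyK.
  by right; exists K; rewrite // inE eqxx.
have [||||[F FL xyF]] := cov x y; rewrite ?inE // /edges_off ?xy //; first by left.
by right; exists F; rewrite // inE FL orbT.
Qed.
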